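(* Let $P\in N_1$ be a sum of $10$ monomials, not necessarily distinct (i.e. $P(1)=10$). If $P$ does not have unique factorisation inside $N_1$, then one of the following holds. (A) There are integers $c\ge0$, $d\ge1$ such that $P(X)=X^cQ(X^d)$, where $Q$ is one of $Q_1=(1+X)(1+X^2+X^4+X^6+X^8)=(1+X^5)(1+X+X^2+X^3+X^4)$, $Q_2=(1+X)(1+X^4+X^6+X^8+X^{12})=(1+X^5)(1+X+X^4+X^7+X^8)$, $Q_3=(1+X^3)(1+X^2+X^4+X^6+X^8)=(1+X^5)(1+X^2+X^3+X^4+X^6)$. (B) There are integers $c\ge0$, $a\ge0$, $b\ge1$ such that $P=X^c\cdot F$, where $F$ is one of $(1+X^{3b})(1+X^a+X^b+X^{a+b}+X^{a+2b})=(1+X^b)(1+X^a+X^{a+2b}+X^{3b}+X^{a+4b})$, $(1+X^{3b})(1+X^a+X^b+X^{a+b}+X^{2b})=(1+X^b)(1+X^a+X^{2b}+X^{a+3b}+X^{4b})$.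
   Context: $N_1=\mathbb{Z}_{\ge0}[X]$ is the semiring of univariate polynomials with nonnegative integer coefficients. An element $Q\neq0,1$ of $N_1$ is irreducible if in every factorisation $Q=ST$ with $S,T\in N_1$ one of $S,T$ is $1$. $P$ has unique factorisation in $N_1$ if any two factorisations of $P$ into irreducibles of $N_1$ coincide up to order of the factors. *)

(* Defs.v *)
From HB Require Import structures.
From mathcomp Require Import all_boot all_order all_algebra.
Set Implicit Arguments. Unset Strict Implicit. Unset Printing Implicit Defensive.
Import GRing.Theory.
Local Open Scope ring_scope.

Definition N1 := {poly nat}.

Definition irreducibleN1 (Q : {poly nat}) : Prop :=
  Q <> 0 /\ Q <> 1 /\
  forall S T : {poly nat}, Q = S * T -> S = 1 \/ T = 1.

Definition unique_factN1 (P : {poly nat}) : Prop :=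
  forall s t : seq {poly nat},
    (forall q, q \in s -> irreducibleN1 q) ->
    (forall q, q \in t -> irreducibleN1 q) ->
    \prod_(q <- s) q = P -> \prod_(q <- t) q = P ->
    perm_eq s t.

(* Main.v *)
(** Cancelling the power of [X], two different factorisations of a polynomial of value 10 at 1 read
[(1 + X^m) B = (1 + X^n) B'] with [m < n], where [B] and [B'] have five terms and nonzero constant
term. Put [g = gcd m n] and [Y = X^g], and keep only the exponents of a residue class mod [g] to which
[B] contributes an odd number of terms. Dividing by [1 + Y] and setting [Y = -1] gives
[(m/g) b = (n/g) b'], where [b] is odd and [|b| <= 5]; hence [m : n] is [1 : 3], [1 : 5] or [3 : 5],
and when [n = 5g] all exponents of [B] are multiples of [2g].

For [1 : 3], cancelling [1 + Y] shows that each coefficient of [B'] is at most the sum of its two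
neighbours at distance [g], which leaves only family (B). In the other two cases, comparing the terms
of even and odd degree in [Y] determines [B'] completely, and gives [Q_1], [Q_2] and [Q_3]. *)
Require Import Defs.
From HB Require Import structures.
From mathcomp Require Import all_boot all_order all_algebra.
From mathcomp Require Import zify ring.
From Stdlib Require Import Classical.
Import GRing.Theory.
Local Open Scope ring_scope.

(** * Polynomials as multisets of exponents *)

(** Over [nat] a polynomial amounts to a multiset of exponents; listing it turns equality into
    [perm_eq] and the value at 1 into the size. *)
Definition expo_poly (s : seq nat) : {poly nat} := \sum_(i <- s) 'X^i.

Lemma coef_expo_poly s k : (expo_poly s)`_k = count_mem k s.
Proof.
rewrite /expo_poly; elim: s => [|i s IHs]; first by rewrite big_nil coef0.
by rewrite big_cons coefD coefXn IHs /= eq_sym; case: eqP.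
Qed.

Lemma expo_poly_inj s t : expo_poly s = expo_poly t -> perm_eq s t.
Proof.
by move=> est; apply/allP => k _ /=; rewrite -!coef_expo_poly est.
Qed.

Lemma perm_expo_poly s t : perm_eq s t -> expo_poly s = expo_poly t.
Proof. exact: perm_big. Qed.

Lemma expo_poly_cat s t : expo_poly (s ++ t) = expo_poly s + expo_poly t.
Proof. exact: big_cat. Qed.

Lemma expo_poly_shift m s : expo_poly (map (addn m) s) = 'X^m * expo_poly s.
Proof.
by rewrite /expo_poly big_map mulr_sumr; apply: eq_bigr => i _; rewrite exprD.
Qed.

Lemma expo_poly_binomial m s :
  expo_poly (s ++ map (addn m) s) = (1 + 'X^m) * expo_poly s.
Proof. by rewrite expo_poly_cat expo_poly_shift mulrDl mul1r. Qed.

Lemma horner1_expo_poly s : (expo_poly s).[1] = size s.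
Proof.
rewrite /expo_poly; elim: s => [|i s IHs]; first by rewrite big_nil horner0.
by rewrite big_cons hornerD hornerXn expr1n IHs.
Qed.

Lemma expo_polyE p : exists s, p = expo_poly s.
Proof.
exists (flatten [seq nseq (p`_i)%R i | i <- iota 0 (size p)]).
rewrite /expo_poly big_flatten /= big_map -[LHS]coefK poly_def.
rewrite -(big_mkord predT (fun i => p`_i *: 'X^i)) /index_iota subn0.
apply: eq_bigr => i _; rewrite big_nseq.
elim: (p`_i) => [|c IHc]; first exact: scale0r.
symmetry.
by rewrite iterS -IHc -[X in X + _ = _]scale1r -scalerDl.
Qed.

Lemma binomial_cancel m (p q : {poly nat}) :
  (1 + 'X^m) * p = (1 + 'X^m) * q -> p = q.
Proof.
move=> e; apply/polyP => k; elim/ltn_ind: k => k IHk.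
have := congr1 (fun r : {poly nat} => r`_k) e.
rewrite !mulrDl !mul1r !coefD !coefXnM.

case: ltnP => [_|lemk]; first by rewrite !addr0.
(* For [m = 0] the factor is the constant 2, and halving replaces the induction. *)
case: m lemk {e} => [|m] lemk; first by rewrite subn0 !natrDE; lia.
by rewrite (IHk (k - m.+1)%N) ?natrDE; lia.
Qed.

Lemma expXn_cancel c (p q : {poly nat}) : 'X^c * p = 'X^c * q -> p = q.
Proof.
move=> e; apply/polyP => k.
have := congr1 (fun r : {poly nat} => r`_(k + c)) e.
by rewrite !coefXnM ltnNge leq_addl addnK.
Qed.

(** * Invariants of a residue class of exponents *)

(** Equal multisets give every weight [w] the same total; the invariants below come from particular
    choices of [w]. *)
Lemma perm_weight (w : nat -> int) m n s t :
  perm_eq (s ++ map (addn m) s) (t ++ map (addn n) t) ->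
  \sum_(i <- s) (w i + w (m + i)%N) = \sum_(i <- t) (w i + w (n + i)%N).
Proof.
move=> pst; have : \sum_(i <- s ++ map (addn m) s) w i =
  \sum_(i <- t ++ map (addn n) t) w i by exact: perm_big.
by rewrite !big_cat !big_map !big_split.
Qed.

Section Residues.
Variables g r : nat.
Implicit Types (s t : seq nat).

(** Within the class of [r], the quotient by [g] is the exponent of [Y], and its parity is the sign
    of the term at [Y = -1]. *)
Definition even_class s := count (fun i => (i %% g == r)%N && ~~ odd (i %/ g)%N) s.
Definition odd_class s := count (fun i => (i %% g == r)%N && odd (i %/ g)%N) s.
Definition class_size s := count (fun i => i %% g == r)%N s.

Lemma class_sizeE s : class_size s = (even_class s + odd_class s)%N.
Proof.
rewrite /class_size /even_class /odd_class; elim: s => //= i s ->.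
by case: eqP => //= _; case: odd => /=; lia.
Qed.

Definition ind i : int := (i %% g == r)%N%:R.

Lemma class_size_sum s : (class_size s)%:Z = \sum_(i <- s) ind i.
Proof.
elim: s => [|i s IHs]; rewrite ?big_nil // big_cons -IHs /ind /class_size /=.
by case: eqP.
Qed.

Lemma alt_sum s : (even_class s)%:Z - (odd_class s)%:Z =
  \sum_(i <- s) ind i * (-1) ^+ (i %/ g)%N.
Proof.
elim: s => [|i s IHs]; rewrite ?big_nil // big_cons -IHs /ind.
rewrite /even_class /odd_class /= -signr_odd.
by case: eqP => _ /=; case: odd => /=; rewrite ?mulr0n ?mulr1n ?expr0 ?expr1; lia.
Qed.

Variables (m n : nat) (s t : seq nat).
Hypothesis g_gt0 : (0 < g)%N.
Hypothesis perm_st :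
  perm_eq (s ++ map (addn (m * g)) s) (t ++ map (addn (n * g)) t).

Lemma ind_shift k i : ind (k * g + i) = ind i.
Proof. by rewrite /ind modnMDl. Qed.

Lemma divn_shift k i : ((k * g + i) %/ g)%N = (k + i %/ g)%N.
Proof. by rewrite divnMDl. Qed.

Lemma class_size_eq : class_size s = class_size t.
Proof.
have := perm_weight ind _ _ _ _ perm_st.
under eq_bigr do rewrite ind_shift -mulr2n.
under [RHS]eq_bigr do rewrite ind_shift -mulr2n.
by rewrite !sumrMnl -!class_size_sum; lia.
Qed.

(** This evaluates the class at [Y = -1]. For odd [m] and [n] it only says [0 = 0], hence the finer
    identity that follows. *)
Lemma alt_sum_eq :
  ((even_class s)%:Z - (odd_class s)%:Z) * (1 + (-1) ^+ m) =
  ((even_class t)%:Z - (odd_class t)%:Z) * (1 + (-1) ^+ n).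
Proof.
rewrite !alt_sum !mulr_suml.
have := perm_weight (fun i => ind i * (-1) ^+ (i %/ g)%N) _ _ _ _ perm_st.
under eq_bigr do rewrite ind_shift divn_shift exprD [_ ^+ m * _]mulrC mulrA -[X in X + _]mulr1 -mulrDr.
by under [RHS]eq_bigr do rewrite ind_shift divn_shift exprD [_ ^+ n * _]mulrC mulrA -[X in X + _]mulr1 -mulrDr.
Qed.

(* The weight [(-1)^k k] plays the role of dividing by [1 + Y] before setting [Y = -1]. *)
Lemma alt_deriv_eq : odd m -> odd n ->
  ((even_class s)%:Z - (odd_class s)%:Z) * m%:Z =
  ((even_class t)%:Z - (odd_class t)%:Z) * n%:Z.
Proof.
move=> om on; apply: oppr_inj; rewrite -!mulrN !alt_sum !mulr_suml.
pose w i := ind i * (-1) ^+ (i %/ g)%N * (i %/ g)%N%:Z.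
have wE k i : odd k -> w i + w (k * g + i)%N = ind i * (-1) ^+ (i %/ g)%N * - k%:Z.
  move=> ok; rewrite /w ind_shift divn_shift exprD -[_ ^+ k]signr_odd ok expr1.
  by rewrite PoszD; ring.
have := perm_weight w _ _ _ _ perm_st.
under eq_bigr do rewrite wE //.
by under [RHS]eq_bigr do rewrite wE //.
Qed.

End Residues.

(** * The ratio of the two binomial exponents *)

Lemma odd_class_exists g s : (0 < g)%N -> odd (size s) ->
  exists r, odd (class_size g r s).
Proof.
case: g => // g _; have -> : size s = (\sum_(r < g.+1) class_size g.+1 r s)%N.
  rewrite -sum1_size (partition_big (fun i => inord (i %% g.+1)%N : 'I_g.+1) predT) //.
  apply: eq_bigr => r _; rewrite /class_size -sum1_count.
  by apply: eq_bigl => i; rewrite -val_eqE /= inordK // ltn_pmod.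
case: (pickP (fun r : 'I_g.+1 => odd (class_size g.+1 r s))) => [r or _|ev].
  by exists r.
rewrite (big_morph odd oddD (erefl _)) big1 // => r _; exact: ev.
Qed.

Lemma binomial_ratio (m n : nat) (s t : seq nat) : (m < n)%N -> size s = 5%N -> 0%N \in s ->
  perm_eq (s ++ map (addn m) s) (t ++ map (addn n) t) ->
  exists2 d : nat, (0 < d)%N &
    m = d /\ n = (3 * d)%N \/
    [/\ m = d \/ m = (3 * d)%N, n = (5 * d)%N,
        all (dvdn (2 * d)) s & all (dvdn d) t].
Proof.
move=> ltmn sz5 s0 pst.
have g_gt0 : (0 < gcdn m n)%N by rewrite gcdn_gt0; lia.
have sz5' : size t = 5%N.
  by move: (perm_size pst); rewrite !size_cat !size_map sz5; move: (size t) => k; lia.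
move: (divnK (dvdn_gcdl m n)) (divnK (dvdn_gcdr m n)).
set g := gcdn m n in g_gt0 *; set m' := (m %/ g)%N; set n' := (n %/ g)%N => Em En.
have co : coprime n' m'.
  rewrite /coprime -(eqn_pmul2r g_gt0) mul1n muln_gcdl Em En gcdnC; exact/eqP.
exists g => //.
have {}ltmn : (m' < n')%N by rewrite -(ltn_pmul2r g_gt0) Em En.
rewrite -Em -En in pst *; clear Em En; clearbody m' n' g; clear m n.
(* In a class of odd size the even and odd counts differ by an odd, hence nonzero, number. *)
have [|r odd_r] := @odd_class_exists g s g_gt0; first by rewrite sz5.
have cE := class_size_eq g r _ _ _ _ g_gt0 pst.
have sE := class_sizeE g r s; have tE := class_sizeE g r t.
have aE := alt_sum_eq g r _ _ _ _ g_gt0 pst.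
have dE := alt_deriv_eq g r _ _ _ _ g_gt0 pst.
have les : (class_size g r s <= 5)%N by rewrite -sz5 count_size.
set es := even_class g r s in sE aE dE *; set os := odd_class g r s in sE aE dE *.
set et := even_class g r t in tE aE dE *; set ot := odd_class g r t in tE aE dE *.
have odd_s : odd (es + os) by rewrite -sE.
have odd_t : odd (et + ot) by rewrite -tE -cE.
have sgE k : 1 + (-1) ^+ k = if odd k then 0 else 2%:Z.
  by rewrite -signr_odd; case: odd.
rewrite !sgE in aE.
(* Coprimality forbids two even exponents. If exactly one is even, [aE] equates 0 with twice an odd
   number. *)
have om : odd m'.
  case om : (odd m') aE => //; have -> /= : odd n'.
    by move: co; rewrite -[m']odd_double_half om add0n -muln2 coprimeMr coprimen2 => /andP[].
  by clearbody es os et ot; lia.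
have on : odd n'.
  by clearbody es os et ot; case on : (odd n') aE => //=; rewrite om /=; lia.
have {aE}{}dE := dE om on.
(* Since [n'] is prime to [m'], it divides the factor [es - os]. *)
have [k kE] : exists k : int, es%:Z - os%:Z = k * n'%:Z.
  apply/dvdzP; have := dvdz_mull (et%:Z - ot%:Z) (dvdzz n'%:Z).
  by rewrite -dE Gauss_dvdzl.
(* A nonzero multiple of [n'] has absolute value at most [es + os <= 5]; for [n' = 5] equality holds
   and one of the counts vanishes. *)
rewrite sE in les; have [n'_le c5] :
  (n' <= 5)%N /\ (n' = 5%N -> (es = 5%N /\ os = 0%N) \/ (es = 0%N /\ os = 5%N)).
  clearbody es os; clear -kE odd_s les; have k0 : k <> 0 by nia.
  by split; nia.
have [n3|n5] : n' = 3%N \/ n' = 5%N by lia.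
  have m1 : m' = 1%N by lia.
  by left; rewrite n3 m1 mul1n.
right; subst n'.
(* All five exponents of [s] share residue and parity, and the exponent 0 makes the residue 0 and
   the parity even. *)
have [[e5 o0]|[_ o5]] := c5 erefl.
  have all_e : all (fun i => ((i %% g == r) && ~~ odd (i %/ g))%N) s.
    by rewrite all_count sz5; apply/eqP.
  have r0 : r = 0%N by have /andP[/eqP <- _] := allP all_e _ s0; rewrite mod0n.
  split => //; first by have [->|->] : m' = 1%N \/ m' = 3%N by [lia]; [left; rewrite mul1n | right].
    apply/allP => i /(allP all_e)/andP[]; rewrite r0 -/(dvdn g i) => /dvdnP[q ->].
    by rewrite mulnK // dvdn_pmul2r // dvdn2.
  have: all (fun i => i %% g == r)%N t by rewrite all_count sz5'; apply/eqP; rewrite -[LHS]cE sE e5 o0.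
  by rewrite r0.
have /allP/(_ _ s0) : all (fun i => ((i %% g == r) && odd (i %/ g))%N) s.
  by rewrite all_count sz5; apply/eqP.
by rewrite div0n andbF.
Qed.

(** * The ratios 1 : 5 and 3 : 5 *)

(** The even part of the identity expresses [s] through [t]; the odd part does so for [s] shifted by
    [m]. Eliminating [s] leaves a condition on [t] alone. *)
Lemma parity_split (m n : nat) (s t : seq nat) : odd m -> odd n -> ~~ has odd s ->
  perm_eq (s ++ map (addn m) s) (t ++ map (addn n) t) ->
  perm_eq (map (addn m) (filter (predC odd) t) ++ map (addn (m + n)) (filter odd t))
    (filter odd t ++ map (addn n) (filter (predC odd) t)).
Proof.
move=> om on /hasPn es pst.
have odd_shift k u : odd k -> filter odd (map (addn k) u) = map (addn k) (filter (predC odd) u).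
  by move=> ok; rewrite filter_map; congr map; apply: eq_filter => i; rewrite /= oddD ok.
have even_shift k u : odd k -> filter (predC odd) (map (addn k) u) = map (addn k) (filter odd u).
  move=> ok; rewrite filter_map; congr map; apply: eq_filter => i.
  by rewrite /= oddD ok /= negbK.
have s_odd : filter odd s = [::].
  by apply/eqP/negPn; rewrite -has_filter; apply/hasPn.
have s_even : filter (predC odd) s = s by apply/all_filterP/allP.
have := perm_filter odd pst; rewrite !filter_cat !odd_shift // s_odd s_even /=.
have := perm_filter (predC odd) pst.
rewrite !filter_cat !even_shift // s_odd s_even cats0.
move=> /(perm_map (addn m)); rewrite map_cat -map_comp => pE.
rewrite perm_sym in pE; apply: perm_trans.
by rewrite (eq_map (addnA m n)) in pE.
Qed.

Lemma sumn_shift k (s : seq nat) : sumn (map (addn k) s) = (k * size s + sumn s)%N.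
Proof. by elim: s => [|i s IHs] /=; rewrite ?muln0 ?IHs; lia. Qed.

Lemma perm_of_uniq_sub (s t : seq nat) : uniq s -> {subset s <= t} -> size t = size s -> perm_eq t s.
Proof.
move=> us st sz; have [e eq_st] := uniq_min_size us st (eq_leq sz).
by apply: uniq_perm => //; rewrite ?(leq_size_uniq us st (eq_leq sz)).
Qed.

(** [E] and [O] stand for the even and odd exponents of [B'] in [Y]; the hypothesis is the outcome
    of [parity_split] for [n = 5]. *)
Section RatioFive.
Variables (m : nat) (E O : seq nat).
Hypothesis perm_EO : perm_eq (map (addn m) E ++ map (addn (m + 5)) O) (O ++ map (addn 5) E).

(** Adding up all exponents on each side, the sums of [E] and of [O] cancel. Together with a total
    of five terms this fixes both sizes. *)
Lemma size_balance : (m * size E + (m + 5) * size O = 5 * size E)%N.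
Proof. by have := perm_sumn perm_EO; rewrite !sumn_cat !sumn_shift; lia. Qed.

Lemma mem_shift k (s : seq nat) x : ((x \in map (addn k) s) = (k <= x) && ((x - k)%N \in s))%N.
Proof.
apply/mapP/andP => [[y ys ->]|[lekx xs]]; first by rewrite leq_addr addKn.
by exists (x - k)%N; rewrite ?subnKC.
Qed.

(** This lemma and the next two follow a single exponent to its possible origins on the other side
    of the identity. *)
Lemma memL x : x \in E -> (m + x)%N \in O \/ (5 <= m + x)%N /\ (m + x - 5)%N \in E.
Proof.
move=> xE; have : (m + x)%N \in O ++ map (addn 5) E.
  by rewrite -(perm_mem perm_EO) mem_cat map_f.
by rewrite mem_cat mem_shift => /orP[|/andP]; [left|right].
Qed.

Lemma memR x : x \in E ->
  (m <= 5 + x)%N /\ (5 + x - m)%N \in E \/ (m <= x)%N /\ (x - m)%N \in O.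
Proof.
move=> xE; have : (5 + x)%N \in map (addn m) E ++ map (addn (m + 5)) O.
  by rewrite (perm_mem perm_EO) mem_cat map_f // orbT.
rewrite mem_cat !mem_shift [(m + 5)%N]addnC leq_add2l subnDl.
by move=> /orP[/andP|/andP]; [left|right].
Qed.

Lemma memO5 x : x \in O ->
  (m + 5 + x)%N \in O \/ (m + x)%N \in E.
Proof.
move=> xO; have : (m + 5 + x)%N \in O ++ map (addn 5) E.
  by rewrite -(perm_mem perm_EO) mem_cat map_f ?orbT.
rewrite mem_cat mem_shift => /orP[|/andP[_ xE]]; [by left|right].
by move: xE; rewrite -addnA addnCA addKn.
Qed.

End RatioFive.

(** The sizes are 3 and 2. Following 0 puts 1 in [O] and 4 in [E]; following 4 puts 8 in [E] or 3 in
    [O]. Following 1 then supplies the last exponent, leading to [Q_2] or [Q_1] respectively. *)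
Lemma ratio_one_five (E O : seq nat) :
  perm_eq (map (addn 1) E ++ map (addn 6) O) (O ++ map (addn 5) E) ->
  (size E + size O = 5)%N -> 0%N \in E ->
  perm_eq E [:: 0; 2; 4]%N /\ perm_eq O [:: 1; 3]%N \/
  perm_eq E [:: 0; 4; 8]%N /\ perm_eq O [:: 1; 7]%N.
Proof.
move=> pEO sz E0; have bal := size_balance 1 _ _ pEO.
have sE : size E = 3%N by lia.
have sO : size O = 2%N by lia.
have O1 : 1%N \in O by case: (memL 1 _ _ pEO _ E0) => // -[].
have E4 : 4%N \in E by case: (memR 1 _ _ pEO _ E0) => -[].
have E_cases x : x \in E -> forall y, y \in E -> y != x -> x != 0%N -> y != 0%N ->
    perm_eq E [:: 0; x; y]%N.
  move=> xE y yE nyx nx ny; apply: perm_of_uniq_sub; rewrite ?sE //=.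
    by rewrite !inE negb_or [0 == x]eq_sym [0 == y]eq_sym nx ny eq_sym nyx.
  by move=> z; rewrite !inE => /or3P[]/eqP->.
have O_cases x : x \in O -> x != 1%N -> perm_eq O [:: 1; x]%N.
  move=> xO nx; apply: perm_of_uniq_sub; rewrite ?sO //=.
    by rewrite inE eq_sym nx.
  by move=> z; rewrite !inE => /orP[]/eqP->.
have [[_ E8]|[_ O3]] := memR 1 _ _ pEO _ E4.
  have pE := E_cases _ E4 _ E8 isT isT isT; right; split => //; apply: O_cases => //.
  by case: (memO5 1 _ _ pEO _ O1) => //; rewrite (perm_mem pE).
left; have pO := O_cases _ O3 isT; split => //.
by apply: E_cases => //; case: (memO5 1 _ _ pEO _ O1) => //; rewrite (perm_mem pO).
Qed.

(** The sizes are 4 and 1. As 3 is the only element of [O], following 0, 2 and 4 yields 2, 4 and 6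
    in [E], which is [Q_3]. *)
Lemma ratio_three_five (E O : seq nat) :
  perm_eq (map (addn 3) E ++ map (addn 8) O) (O ++ map (addn 5) E) ->
  (size E + size O = 5)%N -> 0%N \in E ->
  perm_eq E [:: 0; 2; 4; 6]%N /\ perm_eq O [:: 3]%N.
Proof.
move=> pEO sz E0; have bal := size_balance 3 _ _ pEO.
have sE : size E = 4%N by lia.
have sO : size O = 1%N by lia.
have O3 : 3%N \in O by case: (memL 3 _ _ pEO _ E0) => // -[].
have pO : perm_eq O [:: 3]%N.
  by apply: perm_of_uniq_sub => // z; rewrite inE => /eqP->.
have E2 : 2%N \in E by case: (memR 3 _ _ pEO _ E0) => -[].
have E4 : 4%N \in E by case: (memR 3 _ _ pEO _ E2) => -[].
have E6 : 6%N \in E by case: (memR 3 _ _ pEO _ E4) => -[] //; rewrite (perm_mem pO).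
split => //; apply: perm_of_uniq_sub => // z.
by rewrite !inE => /or4P[]/eqP->.
Qed.

(** * The ratio 1 : 3 *)

Ltac decide_eqs := repeat match goal with |- context [@eq_op _ ?a ?b] =>
  first [ (have -> : (a == b) = true by clear; lia) | (have -> : (a == b) = false by lia)
        | (have -> : (a == b) = true by lia)] end.

(** The remaining finite case, scaled to [g = 1] and checked by computation. Values [k > 4] impose
    nothing, since their count is 0. *)
Lemma five_sorted_small :
  (all (fun a => all (fun b => all (fun d => (a <= b) ==> (b <= d) ==>
    all (fun k => count_mem k [:: 0; 1; a; b; d] <= count_mem k.+1 [:: 0; 1; a; b; d] +
      if k < 1 then 0 else count_mem k.-1 [:: 0; 1; a; b; d]) (iota 0 5) ==>
    [|| (b == a + 1) && (d == a + 2), (b == a + 1) && (d == 2),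
        (d == a + 1) && (b == 2) | (a == 2) && (d == b + 1)])
  (iota 0 5)) (iota 0 5)) (iota 0 5))%N.
Proof. by vm_compute. Qed.

(* Every exponent has a neighbour at distance [g] in the list. Besides the four patterns this only
   leaves a few coincidences, excluded by counting at a single exponent, and lists of multiples of
   [g] up to [4 g]. *)
Lemma five_sorted (g x y z : nat) : (0 < g)%N -> (x <= y)%N -> (y <= z)%N ->
  let c k := count_mem k [:: 0; g; x; y; z]%N in
  (forall k, c k <= c (k + g) + (if k < g then 0 else c (k - g)))%N ->
  (y = x + g /\ z = x + 2 * g \/
      y = x + g /\ z = 2 * g \/
      z = x + g /\ y = 2 * g \/
      x = 2 * g /\ z = y + g)%N.
Proof.
move=> g0 xy yz c cP.
have M k : (0 < c k)%N -> (k = 0 \/ k = g \/ k = x \/ k = y \/ k = z)%N.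
  rewrite /c /=; case: (0%N =P k); case: (g =P k); case: (x =P k); case: (y =P k);
    case: (z =P k); lia.
have cx : (0 < c x)%N by rewrite /c /= eqxx; lia.
have cy : (0 < c y)%N by rewrite /c /= eqxx; lia.
have cz : (0 < c z)%N by rewrite /c /= eqxx; lia.
have N k : (0 < c k)%N ->
  (k + g = x \/ k + g = y \/ k + g = z \/ k = 0 \/ k = g \/ k = 2 * g \/
   k = x + g \/ k = y + g \/ k = z + g)%N.
  move=> ck; have := cP k.
  case: (posnP (c (k + g)%N)) => [-> |/M]; last by clear -g0; lia.
  case: ltnP => lekg; first by lia.
  move=> h; have /M : (0 < c (k - g))%N by lia.
  by clear -g0 lekg; lia.
have Nx := N x cx; have Ny := N y cy; have Nz := N z cz.
have c0 := cP 0%N; have cg := cP g; have ccx := cP x; have ccy := cP y; have ccz := cP z.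
have : (y = x + g /\ z = x + 2 * g \/
      y = x + g /\ z = 2 * g \/
      z = x + g /\ y = 2 * g \/
      x = 2 * g /\ z = y + g)%N \/
   ((y = x \/ y = z \/ y = 0 \/ y = g) /\ z = x + g)%N \/
   ((x = 0 \/ x = g) /\ z = y + g)%N \/
   ((x = 0 \/ x = g \/ x = 2 * g \/ x = 3 * g \/ x = 4 * g) /\
   (y = 0 \/ y = g \/ y = 2 * g \/ y = 3 * g \/ y = 4 * g) /\
   (z = 0 \/ z = g \/ z = 2 * g \/ z = 3 * g \/ z = 4 * g))%N.
  clear -g0 xy yz Nx Ny Nz.
  case: Nx => [?|[?|[?|[?|[?|[?|[?|[?|?]]]]]]]]; try (exfalso; lia);
  case: Ny => [?|[?|[?|[?|[?|[?|[?|[?|?]]]]]]]]; try (exfalso; lia);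
  case: Nz => [?|[?|[?|[?|[?|[?|[?|[?|?]]]]]]]]; try (exfalso; lia); subst; lia.
rewrite /c in c0 cg ccx ccy ccz.
case=> // -[[[e|[e|[e|e]]] ez]|[[[e|e] ez]|[ex [ey ez]]]].
(* In each of the six coincidences the inequality fails at a repeated exponent; a special value of
   [x] or [y] that gives one of the four patterns is split off first. *)
- subst; clear -g0 ccx; case: (x =P 2 * g)%N => e2; first lia.
  move: ccx; rewrite /=; case: ltnP => ?; case: (x =P 0)%N => ?; case: (x =P g) => ?;
    try (exfalso; lia); decide_eqs; lia.
- subst; clear -g0 ccz; case: (x =P g)%N => e2; first lia.
  by move: ccz; rewrite /=; case: ltnP => ?; first lia; case: (x =P 0)%N => e0; decide_eqs; lia.
- by subst; clear -g0 xy c0; move: c0; rewrite /= g0; decide_eqs; lia.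
- subst; clear -g0 xy cg; move: cg; rewrite /= ltnn subnn.
  by case: (x =P 0)%N => ?; case: (x =P g) => ?; decide_eqs; lia.
- subst; clear -g0 c0; case: (y =P g) => ?; first lia.
  by move: c0; rewrite /= g0; case: (y =P 0)%N => ?; decide_eqs; lia.
- subst; clear -g0 xy cg; case: (y =P 2 * g)%N => ?; first lia.
  by move: cg; rewrite /= ltnn subnn; case: (y =P g)%N => ?; decide_eqs; lia.
have small u : (u = 0 \/ u = g \/ u = 2 * g \/ u = 3 * g \/ u = 4 * g)%N ->
    exists2 a, a \in iota 0 5 & u = (a * g)%N.
  by case=> [|[|[|[|]]]] ->; [exists 0%N|exists 1%N|exists 2%N|exists 3%N|exists 4%N];
    rewrite ?mul1n.
have {ex}[a a5 xE] := small x ex; have {ey}[b b5 yE] := small y ey.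
have {ez small}[d d5 zE] := small z ez.
(* Dividing all exponents by [g] reduces the inequalities to those of the finite check. *)
have cE k : c (k * g)%N = count_mem k [:: 0; 1; a; b; d]%N.
  have lE : [:: 0; g; x; y; z]%N = map (muln^~ g) [:: 0; 1; a; b; d]%N.
    by rewrite /= mul1n xE yE zE.
  by rewrite /c lE count_map; apply: eq_count => j; rewrite /= eqn_pmul2r.
rewrite xE yE zE in xy yz *; rewrite !leq_pmul2r // in xy yz.
have /implyP/(_ xy)/implyP/(_ yz)/implyP := allP (allP (allP five_sorted_small _ a5) _ b5) _ d5.
case/(_ _)/or4P => [|/andP[/eqP-> /eqP->]|/andP[/eqP-> /eqP->]|/andP[/eqP-> /eqP->]|/andP[/eqP-> /eqP->]]; try lia.
apply/allP => k _; have := cP (k * g)%N; rewrite cE -mulSnr cE.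
case: k => [|k]; first by rewrite mul0n g0.
by rewrite ltnNge leq_pmull // mulSnr addnK cE.
Qed.

(** From [1 + Y^3 = (1 + Y)(1 - Y + Y^2)], cancelling [1 + Y] gives [s + Y t = (1 + Y^2) t] without
    subtraction. The bound is the coefficient at [k + g] with the term of [s] dropped. *)
Lemma one_three_counts g s t :
  (1 + 'X^g) * expo_poly s = (1 + 'X^(3 * g)) * expo_poly t ->
  forall k, (count_mem k t <= count_mem (k + g) t + if k < g then 0 else count_mem (k - g) t)%N.
Proof.
move=> e k; have : expo_poly s + 'X^g * expo_poly t = (1 + 'X^g * 'X^g) * expo_poly t.
  apply: (@binomial_cancel g); rewrite mulrDr e mulnC exprM; ring.
move/(congr1 (fun p : {poly nat} => p`_(k + g)%N)).
rewrite mulrDl mul1r -mulrA !coefD !coefXnM !coef_expo_poly !natrDE.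
by rewrite ltnNge leq_addl addnK /=; case: ltnP => _; lia.
Qed.

(** The inequality at 0 forces [g] into [t]; the three other exponents are sorted to reduce the
    number of cases. *)
Lemma five_exponents (g : nat) (t : seq nat) : (0 < g)%N -> size t = 5%N -> 0%N \in t ->
  (forall k, count_mem k t <= count_mem (k + g) t + if k < g then 0 else count_mem (k - g) t)%N ->
  exists a, perm_eq t [:: 0; a; g; a + g; a + 2 * g]%N \/ perm_eq t [:: 0; a; g; a + g; 2 * g]%N.
Proof.
move=> g0 sz t0 tP.
have tg : g \in t.
  have := tP 0%N; rewrite g0 addn0 add0n -has_pred1 has_count => /(leq_trans _); apply.
  by rewrite -has_count has_pred1.
have [v tE] : exists v, perm_eq t [:: 0%N, g & v].
  have gv : g \in rem 0%N t.
    by have := tg; rewrite (perm_mem (perm_to_rem t0)) inE; case: eqP g0 => // ->.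
  exists (rem g (rem 0%N t)); apply: perm_trans (perm_to_rem t0) _.
  by rewrite perm_cons; apply: perm_to_rem.
have tE' : perm_eq t [:: 0%N, g & sort leq v].
  by apply: perm_trans tE _; rewrite !perm_cons perm_sym perm_sort.
have := sort_sorted leq_total v; have := perm_size tE'.
move: (sort leq v) tE' => [|x [|y [|z [|? ?]]]] tE'; rewrite sz //= => _ /and3P[xy yz _].
have cP k : count_mem k t = count_mem k [:: 0; g; x; y; z]%N by apply/permP.
(* The last three alternatives are one multiset, with [2 * g] in last, middle or first place. *)
case: (@five_sorted g x y z g0 xy yz) => [k|[yE zE]|[[yE zE]|[[zE yE]|[xE zE]]]].
- by rewrite -!cP.
- by exists x; left; apply: perm_trans tE' _; rewrite yE zE; apply/permP => p /=; lia.
- by exists x; right; apply: perm_trans tE' _; rewrite yE zE; apply/permP => p /=; lia.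
- by exists x; right; apply: perm_trans tE' _; rewrite yE zE; apply/permP => p /=; lia.
- by exists y; right; apply: perm_trans tE' _; rewrite xE zE; apply/permP => p /=; lia.
Qed.

Lemma one_three (g : nat) (s t : seq nat) : (0 < g)%N -> size t = 5%N -> 0%N \in t ->
  (1 + 'X^g) * expo_poly s = (1 + 'X^(3 * g)) * expo_poly t ->
  exists a : nat,
    expo_poly t = 1 + 'X^a + 'X^g + 'X^(a + g) + 'X^(a + 2 * g) \/
    expo_poly t = 1 + 'X^a + 'X^g + 'X^(a + g) + 'X^(2 * g).
Proof.
move=> g0 sz t0 /one_three_counts/(five_exponents g t g0 sz t0)[a ta]; exists a.
by case: ta => /perm_expo_poly ->; [left | right]; rewrite /expo_poly !big_cons big_nil;
  rewrite expr0 addr0 !addrA.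
Qed.

(** * Classification of pairs of products *)

(** Dividing exponents by [g] makes those of [s] even, so [parity_split] applies to the
    quotients. *)
Lemma parity_cases (g m : nat) (s t : seq nat) :
  (0 < g)%N -> odd m -> size t = 5%N -> 0%N \in t ->
  all (dvdn (2 * g)) s -> all (dvdn g) t ->
  perm_eq (s ++ map (addn (m * g)) s) (t ++ map (addn (5 * g)) t) ->
  exists E O, [/\ perm_eq t (map (muln g) (E ++ O)), (size E + size O = 5)%N, 0%N \in E &
    perm_eq (map (addn m) E ++ map (addn (m + 5)) O) (O ++ map (addn 5) E)].
Proof.
move=> g0 om sz t0 ds dt pst.
have scale u : all (dvdn g) u -> map (muln g) (map (divn^~ g) u) = u.
  move=> du; rewrite -map_comp; apply: map_id_in => i /(allP du) gi /=.
  by rewrite mulnC divnK.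
have ginj : injective (muln g) by move=> u v /eqP; rewrite eqn_pmul2l // => /eqP.
have ds' : all (dvdn g) s by apply: sub_all ds => i; apply: dvdn_trans; rewrite dvdn_mull.
rewrite -(scale s ds') -(scale t dt) in t0 pst *.
set s1 := map (divn^~ g) s in pst; set t1 := map (divn^~ g) t in t0 pst *.
have shift k u : map (addn (k * g)) (map (muln g) u) = map (muln g) (map (addn k) u).
  by rewrite -!map_comp; apply: eq_map => i /=; rewrite mulnDr mulnC.
rewrite !shift -!map_cat in pst; have {}pst := perm_map_inj ginj pst.
exists (filter (predC odd) t1), (filter odd t1); split.
- by apply: perm_map; rewrite perm_sym perm_catC perm_filterC.
- by rewrite !size_filter addnC count_predC /t1 size_map.
- move: t0; rewrite mem_filter -{1}[0%N](muln0 g) mem_map //.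
- apply: parity_split pst => //; rewrite has_map; apply/hasPn => i /(allP ds) /dvdnP[q ->] /=.
  by rewrite mulnA mulnK // oddM andbF.
Qed.

Lemma classification (m n : nat) (s t : seq nat) : (m < n)%N -> size s = 5%N ->
  0%N \in s -> 0%N \in t ->
  (1 + 'X^m) * expo_poly s = (1 + 'X^n) * expo_poly t ->
  (exists2 d : nat, (1 <= d)%N &
     ((1 + 'X^n) * expo_poly t = (1 + 'X^d) *
            (1 + 'X^(2 * d) + 'X^(4 * d) + 'X^(6 * d) + 'X^(8 * d)) \/
      (1 + 'X^n) * expo_poly t = (1 + 'X^d) *
            (1 + 'X^(4 * d) + 'X^(6 * d) + 'X^(8 * d) + 'X^(12 * d)) \/
      (1 + 'X^n) * expo_poly t = (1 + 'X^(3 * d)) *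
            (1 + 'X^(2 * d) + 'X^(4 * d) + 'X^(6 * d) + 'X^(8 * d))))
  \/
  (exists a b : nat, (1 <= b)%N /\
     ((1 + 'X^n) * expo_poly t = (1 + 'X^(3 * b)) *
            (1 + 'X^a + 'X^b + 'X^(a + b) + 'X^(a + 2 * b)) \/
      (1 + 'X^n) * expo_poly t = (1 + 'X^(3 * b)) *
            (1 + 'X^a + 'X^b + 'X^(a + b) + 'X^(2 * b)))).
Proof.
move=> ltmn sz s0 t0 e.
have pst : perm_eq (s ++ map (addn m) s) (t ++ map (addn n) t).
  by apply: expo_poly_inj; rewrite !expo_poly_binomial.
have szt : size t = 5%N.
  by move: (perm_size pst); rewrite !size_cat !size_map sz; move: (size t) => k; lia.
have [d d0 [[mE nE]|[mE nE ds dt]]] := binomial_ratio m n s t ltmn sz s0 pst.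
  subst m n; right; have [a [->|->]] := one_three d s t d0 szt t0 e.
    by exists a, d; split => //; left.
  by exists a, d; split => //; right.
left; exists d => //; subst n.
have [k ok mk] : exists2 k, k = 1%N \/ k = 3%N & m = (k * d)%N.
  by case: mE => ->; [exists 1%N; rewrite ?mul1n; auto | exists 3%N; auto].
have odd_k : odd k by case: ok => ->.
rewrite mk in pst.
have [E [O [/perm_expo_poly -> szEO E0 pEO]]] := parity_cases d k s t d0 odd_k szt t0 ds dt pst.
have final E' O' : perm_eq E E' -> perm_eq O O' ->
    expo_poly (map (muln d) (E ++ O)) = expo_poly (map (muln d) (E' ++ O')).
  by move=> pE pO; apply/perm_expo_poly/perm_map/perm_cat.
case: ok => kE; subst k.
  have [[pE pO]|[pE pO]] := ratio_one_five E O pEO szEO E0.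
    (* Once everything is a polynomial in ['X^d], [ring] matches the two factorisations of [Q_1];
       the same works below for [Q_2] and [Q_3]. *)
    left; rewrite (final _ _ pE pO) /expo_poly /= !big_cons big_nil ![(d * _)%N]mulnC !(mulnC _ d) !exprM.
    ring.
  right; left; rewrite (final _ _ pE pO) /expo_poly /= !big_cons big_nil !(mulnC _ d) !exprM.
  ring.
have [pE pO] := ratio_three_five E O pEO szEO E0.
right; right; rewrite (final _ _ pE pO) /expo_poly /= !big_cons big_nil !(mulnC _ d) !exprM.
ring.
Qed.

(** * Irreducible factors of a polynomial of value 10 at 1 *)

(** A zero constant term splits off a factor ['X], which irreducibility permits only for ['X]
    itself. *)
Lemma irreducible_coef0 q : irreducibleN1 q -> q <> 'X -> q`_0 <> 0%N.
Proof.
move=> [_ [_ irr]] nX q0.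
have qE : q = 'X * \poly_(i < size q) q`_i.+1.
  apply/polyP => -[|k]; rewrite coefXM ?q0 //= coef_poly.
  by case: ltnP => // /leqW; move/leq_sizeP => ->.
case: (irr _ _ qE) => e1; last by rewrite e1 mulr1 in qE.
by have := congr1 (fun p : {poly nat} => p`_0) e1; rewrite coefX coef1.
Qed.

(** The value at 1 counts terms; a single term with nonzero constant coefficient would be the
    polynomial 1. *)
Lemma irreducible_horner1 q : irreducibleN1 q -> q <> 'X -> (2 <= q.[1])%N.
Proof.
move=> irr nX; have q0 := irreducible_coef0 q irr nX; have [_ [n1 _]] := irr.
have [s qE] := expo_polyE q; subst q; move: q0; rewrite horner1_expo_poly coef_expo_poly.
case: s n1 {irr nX} => [|i [|j s]] //= n1 h; exfalso; apply: n1.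
by rewrite /expo_poly big_seq1; case: i h.
Qed.

Lemma prod_ge2_one (v : seq nat) :
  all (leq 2) v -> (\prod_(a <- v) a)%N = 1%N -> v = [::].
Proof.
by case: v => //= a v /andP[a2 _] /eqP; rewrite big_cons muln_eq1 => /andP[/eqP a1]; lia.
Qed.

Lemma prod_ge2_prime p (v : seq nat) : prime p -> all (leq 2) v ->
  (\prod_(a <- v) a)%N = p -> v = [:: p].
Proof.
case: v => [|a v] pp; first by rewrite big_nil => _ p1; rewrite -p1 in pp.
rewrite big_cons /= => /andP[a2 v2] ep.
have v1 : (\prod_(b <- v) b)%N = 1%N.
  have /primeP[_ /(_ a)] := pp; rewrite -{1}ep dvdn_mulr // => /(_ isT)/orP[]/eqP aE; first by lia.
  have := prime_gt0 pp; rewrite -{1}ep aE muln_gt0 => /andP[p0 _].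
  by apply/eqP; rewrite -(eqn_pmul2l p0) muln1 -{1}aE ep.
by rewrite (prod_ge2_one v v2 v1) -ep v1 muln1.
Qed.

Lemma prod_ge2_ten (v : seq nat) : all (leq 2) v -> (\prod_(a <- v) a)%N = 10%N ->
  [\/ v = [:: 10], v = [:: 2; 5] | v = [:: 5; 2]]%N.
Proof.
case: v => [|a v]; rewrite ?big_nil // big_cons /= => /andP[a2 v2] e.
have [[aE vE]|[[aE vE]|[aE vE]]] : (a = 2 /\ \prod_(b <- v) b = 5 \/
  a = 5 /\ \prod_(b <- v) b = 2 \/ a = 10 /\ \prod_(b <- v) b = 1)%N.
- have : a \in divisors 10 by rewrite -dvdn_divisors // -e dvdn_mulr.
  move: (\prod_(b <- v) b)%N e => r e.
  by rewrite [divisors 10]/= !inE => /or4P[] /eqP aE; subst a; lia.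
- by apply: Or32; rewrite aE (prod_ge2_prime 5 v).
- by apply: Or33; rewrite aE (prod_ge2_prime 2 v).
by apply: Or31; rewrite aE (prod_ge2_one v v2 vE).
Qed.

Lemma coef0_prod (u : seq {poly nat}) : (forall q, q \in u -> q`_0 <> 0%N) ->
  (\prod_(q <- u) q)`_0 <> 0%N.
Proof.
elim: u => [_|q u IHu qu]; first by rewrite big_nil coef1.
rewrite big_cons coef0M => /eqP; rewrite natrME muln_eq0 => /orP[] /eqP.
  by apply: qu; rewrite mem_head.
by apply: IHu => r ru; apply: qu; rewrite inE ru orbT.
Qed.

Lemma monomial_part_unique c d (p q : {poly nat}) : p`_0 <> 0%N -> q`_0 <> 0%N ->
  'X^c * p = 'X^d * q -> c = d /\ p = q.
Proof.
wlog lecd : c d p q / (c <= d)%N.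
  move=> W p0 q0 e; case: (leqP c d) => [le|/ltnW le]; first exact: W.
  by have [-> ->] := W d c q p le q0 p0 (esym e).
move=> p0 q0; rewrite -(subnKC lecd) exprD -mulrA => /expXn_cancel e.
have d0 : (d - c)%N = 0%N.
  by case: (d - c)%N e => // k e; move: p0; rewrite e coefXnM.
by rewrite e d0 addn0 mul1r.
Qed.

Lemma two_termsE (p : {poly nat}) : p`_0 <> 0%N -> p.[1] = 2%N -> exists m, p = 1 + 'X^m.
Proof.
have [s ->] := expo_polyE p; rewrite coef_expo_poly horner1_expo_poly.
case: s => [|i [|j [|? ?]]] //= h _.
case: i h => [|i] h; first by exists j; rewrite /expo_poly !big_cons big_nil addr0.
by case: j h => // _; exists i.+1; rewrite /expo_poly !big_cons big_nil addr0 addrC.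
Qed.

(** Evaluation at 1 is multiplicative, and irreducibles other than ['X] have value at least 2. So 10
    arises from one factor, or from one of value 2 and one of value 5. *)
Lemma factorisation_ten P (s : seq {poly nat}) : P.[1] = 10%N ->
  (forall q, q \in s -> irreducibleN1 q) -> \prod_(q <- s) q = P ->
  exists c u, [/\ perm_eq s (nseq c 'X ++ u), P = 'X^c * \prod_(q <- u) q,
    (\prod_(q <- u) q)`_0 <> 0%N &
    (exists2 q, u = [:: q] & irreducibleN1 q) \/
    (exists m v, [/\ u = [:: 1 + 'X^m; expo_poly v], size v = 5%N & 0%N \in v])].
Proof.
move=> P1 irr sP; set c := count (pred1 'X) s; set u := filter (predC1 'X) s.
have pu : perm_eq s (nseq c 'X ++ u).
  have /all_pred1P : all (pred1 'X) (filter (pred1 'X) s) by exact: filter_all.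
  by rewrite size_filter => <-; rewrite perm_sym perm_filterC.
have irr_u q : q \in u -> irreducibleN1 q /\ q <> 'X.
  by rewrite mem_filter => /andP[/eqP nX /irr].
have PE : P = 'X^c * \prod_(q <- u) q.
  rewrite -sP (perm_big _ pu) big_cat /= big_nseq; congr (_ * _).
  by elim: (c) => //= k ->; rewrite exprS.
have u1 : (\prod_(q <- u) q.[1])%N = 10%N.
  by rewrite -P1 PE hornerM hornerXn expr1n mul1r horner_prod.
have ge2 : all (leq 2) (map (horner^~ 1) u).
  by apply/allP => _ /mapP[q /irr_u[iq nX] ->]; exact: irreducible_horner1.
have u0 : (\prod_(q <- u) q)`_0 <> 0%N.
  by apply: coef0_prod => q /irr_u[]; exact: irreducible_coef0.
have two A B : A \in u -> B \in u -> A.[1] = 2%N -> B.[1] = 5%N ->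
    exists m v, [/\ [:: A; B] = [:: 1 + 'X^m; expo_poly v], size v = 5%N & 0%N \in v].
  move=> /irr_u[iA nA] /irr_u[iB nB] A2 B5.
  have [m mE] := two_termsE A (irreducible_coef0 A iA nA) A2.
  have B0 := irreducible_coef0 B iB nB.
  have [v vE] := expo_polyE B; exists m, v; rewrite mE vE; split => //.
    by rewrite -horner1_expo_poly -vE.
  by apply/count_memPn; rewrite -coef_expo_poly -vE.
have := prod_ge2_ten (map (horner^~ 1) u) ge2; rewrite big_map => /(_ u1).
case: u pu irr_u {PE u1 ge2} u0 two PE => [|A [|B [|? ?]]] pu irr_u u0 two PE;
  try by case.
- move=> _; exists c, [:: A]; split => //; left; exists A => //.
  by have [] := irr_u A (mem_head _ _).
case=> // -[A2 B5].
  have [m [v [E v5 v0]]] := two A B (mem_head _ _) (mem_last A [:: B]) A2 B5.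
  by rewrite E in pu PE u0; exists c, [:: 1 + 'X^m; expo_poly v]; split => //; right; exists m, v.
have [m [v [E v5 v0]]] := two B A (mem_last A [:: B]) (mem_head _ _) B5 A2.
have pAB : perm_eq [:: A; B] [:: 1 + 'X^m; expo_poly v] by rewrite -E (perm_catC [:: A] [:: B]).
exists c, [:: 1 + 'X^m; expo_poly v]; split; last by right; exists m, v.
- by apply: perm_trans pu _; rewrite perm_cat2l.
- by rewrite -(perm_big _ pAB).
- by rewrite -(perm_big _ pAB).
Qed.

Theorem mainTheorem12 (P : {poly nat}) :
  P.[1] = 10%N ->
  ~ unique_factN1 P ->
  (exists (c d : nat), (1 <= d)%N /\
     (P = 'X^c * ((1 + 'X^d) *
            (1 + 'X^(2 * d) + 'X^(4 * d) + 'X^(6 * d) + 'X^(8 * d))) \/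
      P = 'X^c * ((1 + 'X^d) *
            (1 + 'X^(4 * d) + 'X^(6 * d) + 'X^(8 * d) + 'X^(12 * d))) \/
      P = 'X^c * ((1 + 'X^(3 * d)) *
            (1 + 'X^(2 * d) + 'X^(4 * d) + 'X^(6 * d) + 'X^(8 * d)))))
  \/
  (exists (c a b : nat), (1 <= b)%N /\
     (P = 'X^c * ((1 + 'X^(3 * b)) *
            (1 + 'X^a + 'X^b + 'X^(a + b) + 'X^(a + 2 * b))) \/
      P = 'X^c * ((1 + 'X^(3 * b)) *
            (1 + 'X^a + 'X^b + 'X^(a + b) + 'X^(2 * b))))).
Proof.
(* Classically, it suffices to show unique factorisation when both families are excluded. *)
move=> P1 nuniq; apply: NNPP => nconcl; apply: nuniq => s t irr_s irr_t sP tP.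
have [c [u [pu PEu u0 uE]]] := factorisation_ten P s P1 irr_s sP.
have [c' [u' [pu' PEu' u0' uE']]] := factorisation_ten P t P1 irr_t tP.
have [cE prodE] := monomial_part_unique c c' _ _ u0 u0' (etrans (esym PEu) PEu').
subst c'; suff uu' : u = u' by rewrite (perm_trans pu) // uu' perm_sym.
(* The factors take the values 2 and 5 at 1, so neither is 1; a single irreducible therefore never
   equals such a product. *)
have irr2 m v q : size v = 5%N -> q = (1 + 'X^m) * expo_poly v -> ~ irreducibleN1 q.
  move=> v5 -> [_ [_ irr]].
  have := congr1 (fun p : {poly nat} => p.[1]); case: (irr _ _ erefl) => e /(_ _ _ e).
    by rewrite hornerD hornerXn expr1n hornerC.
  by rewrite horner1_expo_poly v5 hornerC.
case: uE uE' => [[q qE irr_q]|[m [v [vE v5 v0]]]] [[q' qE' irr_q']|[m' [v' [vE' v5' v0']]]].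
- by move: prodE; rewrite qE qE' !big_seq1 => ->.
- move: prodE; rewrite qE vE' big_seq1 big_cons big_seq1 => /(irr2 _ _ _ v5') h.
  by case: h.
- move: prodE; rewrite vE qE' big_seq1 big_cons big_seq1 => /esym/(irr2 _ _ _ v5) h.
  by case: h.
rewrite vE vE' !big_cons !big_nil !mulr1 in prodE PEu PEu'; rewrite vE vE'.
(* Stated for arbitrary exponents, to serve both orders of [m] and [m']. *)
have concl k l w w' : (k < l)%N -> size w = 5%N -> 0%N \in w -> 0%N \in w' ->
    (1 + 'X^k) * expo_poly w = (1 + 'X^l) * expo_poly w' ->
    P = 'X^c * ((1 + 'X^l) * expo_poly w') -> False.
  move=> ltkl w5 w0 w0' e PE; apply: nconcl; rewrite PE.
  have [[d d0 D]|[a [b [b0 D]]]] := classification k l w w' ltkl w5 w0 w0' e.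
    by left; exists c, d; split => //; case: D => [->|[->|->]]; auto.
  by right; exists c, a, b; split => //; case: D => ->; auto.
case: (ltngtP m m') => [lt|lt|mE].
- by case: (concl _ _ _ _ lt v5 v0 v0' prodE PEu').
- by case: (concl _ _ _ _ lt v5' v0' v0 (esym prodE) PEu).
by subst m'; rewrite (binomial_cancel _ _ _ prodE).
Qed.
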